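(* Let $A\in\mathbb{Q}^{m\times n}$ be a quaternion matrix with nonzero singular values $\sigma_1\ge\sigma_2\ge\cdots\ge\sigma_r>0$, let $N\ge0$ be an integer, and let $X_{0,N}=\alpha A^{H}$ with $0<\alpha<\frac{2}{\sigma_1^2}$. Let $\{X_{j,N}\}_{j\ge0}$ be the sequence generated from $X_{0,N}$ by the QRAPID iteration with step parameter $N$ (defined in the context, run without stopping test). Then $X_{j,N}$ converges to the Moore--Penrose inverse $A^{\dagger}$ as $j\to\infty$, and for all $j\ge0$ $$\|X_{j+1,N}-A^{\dagger}\|\le\begin{cases}\|A^{\dagger}\|\,\|A\|^{5}\,\|X_{j,N}-A^{\dagger}\|^{5}, & N=0,\\ \|A^{\dagger}\|\,\|A\|^{4(N+1)}\,\|X_{j,N}-A^{\dagger}\|^{4(N+1)}, & N=1,2,\\ \|A^{\dagger}\|\,\|A\|^{\nu_N}\,\|X_{j,N}-A^{\dagger}\|^{\nu_N}, & N\ge3,\end{cases}$$ where $$\nu_N=11a_{N-1}+7a_{N-2}+1,\qquad a_N=\frac{\phi^N-(1-\phi)^N}{\sqrt5},\qquad \phi=\frac{1+\sqrt5}{2}.$$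
   Context: $\mathbb{Q}$ denotes the skew field of real quaternions; $A^{H}=\overline{A}^{\top}$ is the conjugate transpose; singular values are those of the quaternion SVD $A=U\Sigma V^{H}$ ($U,V$ unitary quaternion matrices, $\Sigma$ real nonnegative diagonal). $\|\cdot\|$ is the operator 2-norm $\|A\|=\sup_{\|x\|_2=1}\|Ax\|_2$ with $\|x\|_2=\sqrt{x^{H}x}$. The Moore--Penrose inverse $A^{\dagger}$ is the unique $X$ with $AXA=A$, $XAX=X$, $(AX)^{H}=AX$, $(XA)^{H}=XA$. QRAPID iteration with step parameter $N\ge0$: given $X_j\in\mathbb{Q}^{n\times m}$ (written $X_{j,N}$ in the claim), with $I=I_m$, set $P_j=AX_j$, $U_j=\tfrac14X_j\big(13I-P_j(15I-P_j(7I-P_j))\big)$, $V_j=U_j+X_j(I-AU_j)$. If $N=0$ put $Z_0=V_j$. If $N\ge1$ put $Y_0=U_j$, $W_0=V_j$ and for $l=1,\ldots,N$: $Z_l=W_{l-1}+Y_{l-1}(I-AW_{l-1})$, $Y_l=W_{l-1}$, $W_l=Z_l$. Finally $X_{j+1}=Z_N+X_j(I-AZ_N)$. *)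

(* Defs.v *)
From HB Require Import structures.
From mathcomp Require Import all_boot all_order all_algebra.
From mathcomp Require Import all_classical all_reals all_analysis.
From mathcomp Require Import ring lra.
Set Implicit Arguments.
Unset Strict Implicit.
Unset Printing Implicit Defensive.
Import Order.TTheory GRing.Theory Num.Theory.
Import numFieldNormedType.Exports.

Local Open Scope classical_set_scope.
Local Open Scope ring_scope.

(* [Quat a b c d] is the quaternion a + b i + c j + d k. *)
Record quat (R : realType) : Type :=
  Quat { qre : R; qi : R; qj : R; qk : R }.

Definition quat_tuple (R : realType) (x : quat R) : R * R * R * R :=
  (qre x, qi x, qj x, qk x).
Definition tuple_quat (R : realType) (t : R * R * R * R) : quat R :=
  let: (a, b, c, d) := t in Quat a b c d.
Lemma quat_tupleK (R : realType) : cancel (@quat_tuple R) (@tuple_quat R).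
Proof. by case. Qed.

HB.instance Definition _ (R : realType) :=
  Choice.copy (quat R) (can_type (@quat_tupleK R)).

Definition addq (R : realType) (x y : quat R) : quat R :=
  Quat (qre x + qre y) (qi x + qi y) (qj x + qj y) (qk x + qk y).
Definition oppq (R : realType) (x : quat R) : quat R :=
  Quat (- qre x) (- qi x) (- qj x) (- qk x).
Definition mulq (R : realType) (x y : quat R) : quat R :=
  let: Quat a b c d := x in
  let: Quat a' b' c' d' := y in
  Quat (a * a' - b * b' - c * c' - d * d')
       (a * b' + b * a' + c * d' - d * c')
       (a * c' - b * d' + c * a' + d * b')
       (a * d' + b * c' - c * b' + d * a').

Definition qreal (R : realType) (a : R) : quat R := Quat a 0 0 0.

Lemma addqA (R : realType) : associative (@addq R).
Proof. by move=> [????] [????] [????]; rewrite /addq /= !addrA. Qed.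
Lemma addqC (R : realType) : commutative (@addq R).
Proof.
by move=> [a b c d] [a' b' c' d']; rewrite /addq /=; congr Quat; rewrite addrC.
Qed.
Lemma add0q (R : realType) : left_id (qreal (0 : R)) (@addq R).
Proof. by move=> [????]; rewrite /addq /= !add0r. Qed.
Lemma addNq (R : realType) :
  left_inverse (qreal (0 : R)) (@oppq R) (@addq R).
Proof. by move=> [????]; rewrite /addq /= !addNr. Qed.

HB.instance Definition _ (R : realType) :=
  GRing.isZmodule.Build (quat R)
    (@addqA R) (@addqC R) (@add0q R) (@addNq R).

Lemma mulqA (R : realType) : associative (@mulq R).
Proof. by move=> [????] [????] [????]; congr Quat => /=; ring. Qed.
Lemma mul1q (R : realType) : left_id (qreal (1 : R)) (@mulq R).
Proof. by move=> [????]; congr Quat => /=; ring. Qed.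
Lemma mulq1 (R : realType) : right_id (qreal (1 : R)) (@mulq R).
Proof. by move=> [????]; congr Quat => /=; ring. Qed.
Lemma mulqDl (R : realType) : left_distributive (@mulq R) (@addq R).
Proof. by move=> [????] [????] [????]; congr Quat => /=; ring. Qed.
Lemma mulqDr (R : realType) : right_distributive (@mulq R) (@addq R).
Proof. by move=> [????] [????] [????]; congr Quat => /=; ring. Qed.
Lemma oneq_neq0 (R : realType) : qreal (1 : R) != 0.
Proof. by apply/eqP => -[]; apply/eqP; exact: oner_neq0. Qed.

HB.instance Definition _ (R : realType) :=
  GRing.Zmodule_isNzRing.Build (quat R)
    (@mulqA R) (@mul1q R) (@mulq1 R) (@mulqDl R) (@mulqDr R) (@oneq_neq0 R).

Definition conjq (R : realType) (x : quat R) : quat R :=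
  Quat (qre x) (- qi x) (- qj x) (- qk x).

Definition normq2 (R : realType) (x : quat R) : R :=
  qre x ^+ 2 + qi x ^+ 2 + qj x ^+ 2 + qk x ^+ 2.
Definition invq (R : realType) (x : quat R) : quat R :=
  qreal (normq2 x)^-1 * conjq x.

Lemma normq2_eq0 (R : realType) (x : quat R) : (normq2 x == 0) = (x == 0).
Proof.
apply/eqP/eqP => [|->]; last by rewrite /normq2 /= expr0n /= !addr0.
case: x => a b c d; rewrite /normq2 /= => h.
have [ha hb] := (sqr_ge0 a, sqr_ge0 b).
have [hc hd] := (sqr_ge0 c, sqr_ge0 d).
have z (u : R) : u ^+ 2 = 0 -> u = 0 by move/eqP; rewrite sqrf_eq0 => /eqP.
by congr Quat; apply: z; lra.
Qed.

Lemma mulVq (R : realType) (x : quat R) : x != 0 -> invq x * x = 1.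
Proof.
rewrite -normq2_eq0; case: x => a b c d; rewrite /invq /normq2 /= => h.
by congr Quat; rewrite /= -?(mulVf h); ring.
Qed.

Lemma mulqV (R : realType) (x : quat R) : x != 0 -> x * invq x = 1.
Proof.
rewrite -normq2_eq0; case: x => a b c d; rewrite /invq /normq2 /= => h.
by congr Quat; rewrite /= -?(mulVf h); ring.
Qed.

Lemma invq0 (R : realType) : invq (0 : quat R) = 0.
Proof. by congr Quat => /=; ring. Qed.

Lemma quat_unitP (R : realType) (x y : quat R) :
  y * x = 1 /\ x * y = 1 -> x != 0.
Proof.
by move=> [yx _]; apply/eqP => x0; move/eqP: yx;
  rewrite x0 mulr0 eq_sym oner_eq0.
Qed.

Lemma invq_out (R : realType) : {in [predC [pred x : quat R | x != 0]],
  @invq R =1 id}.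
Proof. by move=> x; rewrite !inE negbK => /eqP ->; rewrite invq0. Qed.

HB.instance Definition _ (R : realType) :=
  GRing.NzRing_hasMulInverse.Build (quat R)
    (@mulVq R) (@mulqV R) (@quat_unitP R) (@invq_out R).

Definition adjmx (R : realType) (m n : nat) (A : 'M[quat R]_(m, n)) :
  'M[quat R]_(n, m) := map_mx (@conjq R) A^T.
Notation "A ^H" := (adjmx A) (at level 1, format "A ^H") : ring_scope.

Definition is_unitary (R : realType) (n : nat) (U : 'M[quat R]_n) : Prop :=
  U^H *m U = 1%:M /\ U *m U^H = 1%:M.

(* The rectangular diagonal matrix with diagonal s_0, s_1, ..., padded by
   zeros: [s`_i] is 0 for i >= size s. *)
Definition diag_seq (R : realType) (m n : nat) (s : seq R) :
  'M[quat R]_(m, n) :=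
  \matrix_(i < m, j < n) (if i == j :> nat then qreal s`_i else 0).

(* [s] lists the nonzero singular values of [A], with multiplicity and in
   nonincreasing order; the size bound ensures that every entry of [s] does
   occur on the diagonal of [diag_seq m n s]. *)
Definition nonzero_singular_values (R : realType) (m n : nat)
    (A : 'M[quat R]_(m, n)) (s : seq R) : Prop :=
  [/\ (size s <= minn m n)%N,
      sorted (fun x y : R => y <= x) s,
      all (fun x : R => 0 < x) s &
      exists (U : 'M[quat R]_m) (V : 'M[quat R]_n),
        [/\ is_unitary U, is_unitary V & A = U *m diag_seq m n s *m V^H]].

Definition is_MPinv (R : realType) (m n : nat) (A : 'M[quat R]_(m, n))
    (X : 'M[quat R]_(n, m)) : Prop :=
  [/\ A *m X *m A = A, X *m A *m X = X,
      (A *m X)^H = A *m X & (X *m A)^H = X *m A].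

(* Penrose's equations have at most one solution, and the SVD provides one, so
   the default value 0 of [xget] is never used. *)
Definition MPinv (R : realType) (m n : nat) (A : 'M[quat R]_(m, n)) :
  'M[quat R]_(n, m) := xget 0 [set X | is_MPinv A X].

(* x^H x is a 1 x 1 matrix whose entry is real and nonnegative. *)
Definition vnorm (R : realType) (n : nat) (x : 'cV[quat R]_n) : R :=
  Num.sqrt (qre ((x^H *m x) 0 0)).

(* For n = 0 there is no unit vector, and the supremum is sup set0 = 0. *)
Definition opnorm (R : realType) (m n : nat) (A : 'M[quat R]_(m, n)) : R :=
  sup [set vnorm (A *m x) | x in [set x : 'cV[quat R]_n | vnorm x = 1]].

(* (Y_l, W_l), started at (Y_0, W_0) = (Y, W). *)
Fixpoint qrapid_inner (R : realType) (m n : nat) (A : 'M[quat R]_(m, n))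
    (Y W : 'M[quat R]_(n, m)) (l : nat) :
    'M[quat R]_(n, m) * 'M[quat R]_(n, m) :=
  if l is l'.+1 then
    let: (Y', W') := qrapid_inner A Y W l' in
    (W', W' + Y' *m (1%:M - A *m W'))
  else (Y, W).

(* Z_N is W_N for N >= 1 and V for N = 0, so in both cases it is the second
   component of [qrapid_inner A U V N]. *)
Definition qrapid_step (R : realType) (m n : nat) (N : nat)
    (A : 'M[quat R]_(m, n)) (X : 'M[quat R]_(n, m)) : 'M[quat R]_(n, m) :=
  let P := A *m X in
  let U := 4^-1 *: (X *m (13%:M - P *m (15%:M - P *m (7%:M - P)))) in
  let V := U + X *m (1%:M - A *m U) in
  let Z := (qrapid_inner A U V N).2 in
  Z + X *m (1%:M - A *m Z).

Definition qrapid (R : realType) (m n : nat) (N : nat)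
    (A : 'M[quat R]_(m, n)) (alpha : R) (j : nat) : 'M[quat R]_(n, m) :=
  iter j (qrapid_step N A) (qreal alpha *: A^H).

Definition golden (R : realType) : R := (1 + Num.sqrt 5) / 2.

Definition fibo (R : realType) (N : nat) : R :=
  (golden R ^+ N - (1 - golden R) ^+ N) / Num.sqrt 5.

(* Meant for N >= 2, where the natural subtractions are genuine. *)
Definition nu (R : realType) (N : nat) : R :=
  11 * fibo R (N - 1) + 7 * fibo R (N - 2) + 1.

(* Main.v *)
Require Import Defs.
From HB Require Import structures.
From mathcomp Require Import all_boot all_order all_algebra.
From mathcomp Require Import all_classical all_reals all_analysis.
From mathcomp Require Import ring lra.
Set Implicit Arguments.
Unset Strict Implicit.
Unset Printing Implicit Defensive.
Import Order.TTheory GRing.Theory Num.Theory.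
Import numFieldNormedType.Exports.
Local Open Scope classical_set_scope.
Local Open Scope ring_scope.

(** An SVD A = U S V^H turns the quaternion iteration into independent real
    ones.  The starting point alpha A^H is V (alpha S^T) U^H, and every operation
    of a QRAPID step preserves the shape V D U^H with D real diagonal: U^H U and
    V^H V cancel, and the scalar coefficients are real, hence central.  So
    [X_j = V diag(x_j) U^H], where the i-th entry follows the scalar version
    [scalar_step] of the step for the singular value s_i
    ([qrapid_step_rsvd], [qrapid_rsvd]).  The Moore-Penrose inverse has the same
    shape with entries s_i^-1, where 0^-1 = 0 is the right value ([MPinv_rsvd]),
    and the operator norm of P D Q^H is the largest |d_i|
    ([opnorm_rsvd_le], [opnorm_rsvd_ge]), so each norm estimate is the maximum
    of finitely many scalar ones.

    For one singular value s > 0 put q = 1 - s x.  The residual 1 - s w is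
    multiplicative under the Newton-type correction w + y (1 - s w)
    ([residual_comp]).  The polynomial update that opens a step has residual
    q^3 (3 + q) / 4, of modulus at most |q|^3 once |q| <= 1; its first correction
    has exponent 4, each inner step adds the two previous exponents, and the final
    correction adds 1.  The exponents 3, 4, 7, 11, ... are Lucas numbers, so a step raises |q| to the power
    L_(N+3) + 1 ([residual_step]), which is 5, 8, 12 for N = 0, 1, 2 and nu_N for
    N >= 2 ([nu_lucas]).  As |x - s^-1| = s^-1 |q| and |q| = s |x - s^-1|, this is
    the stated error bound.  The bound on alpha says exactly that every initial
    |q| is below 1, and iterating gives geometric convergence. *)

Local Notation is_unitary := Defs.is_unitary.

(** * Real quaternions and conjugation *)

Section Quaternions.
Variable R : realType.
Implicit Types (x y : quat R) (a b : R).

Lemma qreal_is_zmod_morphism : zmod_morphism (@qreal R).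
Proof. by move=> a b; congr Quat => /=; rewrite ?subr0 ?oppr0 ?addr0. Qed.
Lemma qreal_is_monoid_morphism : monoid_morphism (@qreal R).
Proof. by split=> // a b; congr Quat => /=; ring. Qed.
HB.instance Definition _ := GRing.isZmodMorphism.Build R (quat R) (@qreal R)
  qreal_is_zmod_morphism.
HB.instance Definition _ := GRing.isMonoidMorphism.Build R (quat R) (@qreal R)
  qreal_is_monoid_morphism.

Lemma conjq_is_zmod_morphism : zmod_morphism (@conjq R).
Proof. by case=> [????] [????]; congr Quat => /=; ring. Qed.
HB.instance Definition _ := GRing.isZmodMorphism.Build (quat R) (quat R)
  (@conjq R) conjq_is_zmod_morphism.

Lemma qre_is_zmod_morphism : zmod_morphism (@qre R).
Proof. by case=> [????] [????]. Qed.
HB.instance Definition _ := GRing.isZmodMorphism.Build (quat R) R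
  (@qre R) qre_is_zmod_morphism.

Lemma conjqM x y : conjq (x * y) = conjq y * conjq x.
Proof. by case: x y => [????] [????]; congr Quat => /=; ring. Qed.

Lemma conjq_real a : conjq (qreal a) = qreal a.
Proof. by congr Quat; rewrite /= oppr0. Qed.

Lemma qreal_comm a x : qreal a * x = x * qreal a.
Proof. by case: x => [????]; congr Quat => /=; ring. Qed.

Lemma qrealV a : a != 0 -> (qreal a)^-1 = qreal a^-1.
Proof.
move=> a0; have u : qreal a \is a GRing.unit.
  by apply/eqP => -[] /eqP; rewrite (negbTE a0).
by apply: (mulrI u); rewrite divrr// -rmorphM divff// rmorph1.
Qed.

Lemma qre_conj_real_mul a x :
  qre (conjq x * (qreal a * x)) = a * normq2 x.
Proof. by case: x => [????]; rewrite /normq2 /=; ring. Qed.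

Lemma normq2_ge0 x : 0 <= normq2 x.
Proof. by rewrite /normq2 !addr_ge0 ?sqr_ge0. Qed.

End Quaternions.

(** * Conjugate transposes and uniqueness of the Moore-Penrose inverse *)

Section Adjoint.
Variable R : realType.

Lemma adjmxM m n p (A : 'M[quat R]_(m, n)) (B : 'M[quat R]_(n, p)) :
  (A *m B)^H = B^H *m A^H.
Proof.
apply/matrixP=> i j; rewrite !mxE raddf_sum; apply: eq_bigr => k _.
by rewrite /= conjqM !mxE.
Qed.

Lemma adjmxK m n (A : 'M[quat R]_(m, n)) : A^H^H = A.
Proof.
apply/matrixP=> i j; rewrite !mxE; case: (A i j) => *.
by rewrite /conjq /= !opprK.
Qed.

(** Over a skew field only central scalars can be moved past the left factor;
    real ones are central. *)
Lemma qreal_scalemxAr m n p c (A : 'M[quat R]_(m, n)) (B : 'M[quat R]_(n, p)) :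
  qreal c *: (A *m B) = A *m (qreal c *: B).
Proof.
apply/matrixP=> i j; rewrite !mxE mulr_sumr; apply: eq_bigr => k _.
by rewrite !mxE mulrA qreal_comm mulrA.
Qed.

(** Two Penrose inverses X and Y give the same projectors: A X is Hermitian and
    A X = (A Y) (A X), so taking adjoints A X = (A X) (A Y) = A Y, and likewise
    X A = Y A.  Then X = X A X = X A Y = Y A Y = Y. *)
Lemma MPinv_unique m n (A : 'M[quat R]_(m, n)) X :
  is_MPinv A X -> MPinv A = X.
Proof.
move=> MX; apply: xget_unique => //= Y MY.
have [AXA XAX AXh XAh] := MX; have [AYA YAY AYh YAh] := MY.
have AXY : A *m X = A *m Y.
  by rewrite -AXh -{1}AYA -mulmxA adjmxM AXh AYh !mulmxA AXA.
have XAY : X *m A = Y *m A.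
  rewrite -XAh -{1}AYA !mulmxA -mulmxA adjmxM XAh YAh -!mulmxA.
  by rewrite [A *m (X *m A)]mulmxA AXA.
by rewrite -YAY -XAY -mulmxA -AXY mulmxA.
Qed.

End Adjoint.

(** * Matrices with a real diagonal form *)

Section Diagonal.
Variable R : realType.
Implicit Types d e f : nat -> R.

(** The diagonal is a function on nat, not on ordinals, so that one sequence
    serves the shapes m x n, n x m, m x m and n x n alike. *)
Definition rdiag m n d : 'M[quat R]_(m, n) :=
  \matrix_(i < m, j < n) (if i == j :> nat then qreal (d i) else 0).

Definition rsvd m n (P : 'M[quat R]_m) (Q : 'M[quat R]_n) d :
  'M[quat R]_(m, n) := P *m rdiag m n d *m Q^H.

(** Entries of index at least the inner dimension n are lost in the product,
    which is the reason for the conditional. *)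
Lemma rdiagM m n p d e f :
  (forall i, (i < m)%N -> (i < p)%N ->
     f i = if (i < n)%N then d i * e i else 0) ->
  rdiag m n d *m rdiag n p e = rdiag m p f.
Proof.
move=> fE; apply/matrixP=> i k; rewrite !mxE.
under eq_bigr do rewrite !mxE.
have [ltin|leni] := ltnP i n; last first.
  rewrite big1 => [|j _]; last first.
    case: eqP => [ij|]; last by rewrite mul0r.
    by have := ltn_ord j; rewrite -ij ltnNge leni.
  case: eqP => // ik.
  by rewrite fE ?ltn_ord//; [rewrite ltnNge leni rmorph0|rewrite ik ltn_ord].
rewrite (bigD1 (Ordinal ltin))//= eqxx big1 ?addr0 => [|j jNi]; last first.
  rewrite ifN ?mul0r//; apply: contraNneq jNi => ij.
  exact/eqP/val_inj/esym.
case: eqP => [ik|]; last by rewrite mulr0.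
by rewrite fE ?ltn_ord -?rmorphM ?ltin// ik ltn_ord.
Qed.

Lemma adj_rdiag m n d : (rdiag m n d)^H = rdiag n m d.
Proof.
apply/matrixP=> i j; rewrite !mxE eq_sym; case: eqP => [->|_].
  exact: conjq_real.
exact: raddf0.
Qed.

Lemma adj_rsvd m n (P : 'M[quat R]_m) (Q : 'M[quat R]_n) d :
  (rsvd P Q d)^H = rsvd Q P d.
Proof. by rewrite /rsvd !adjmxM adjmxK adj_rdiag mulmxA. Qed.

Lemma rsvd_ext m n (P : 'M[quat R]_m) (Q : 'M[quat R]_n) d e :
  (forall i, (i < m)%N -> (i < n)%N -> d i = e i) -> rsvd P Q d = rsvd P Q e.
Proof.
move=> de; rewrite /rsvd; congr (_ *m _ *m _); apply/matrixP=> i j.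
by rewrite !mxE; case: eqP => // ij; rewrite de// ij.
Qed.

Lemma rsvdD m n (P : 'M[quat R]_m) (Q : 'M[quat R]_n) d e :
  rsvd P Q d + rsvd P Q e = rsvd P Q (fun i => d i + e i).
Proof.
rewrite /rsvd -mulmxDl -mulmxDr; congr (_ *m _ *m _); apply/matrixP=> i j.
by rewrite !mxE; case: eqP => _; rewrite ?addr0// rmorphD.
Qed.

Lemma rsvdZ m n (P : 'M[quat R]_m) (Q : 'M[quat R]_n) c d :
  qreal c *: rsvd P Q d = rsvd P Q (fun i => c * d i).
Proof.
rewrite /rsvd scalemxAl qreal_scalemxAr; congr (_ *m _ *m _).
apply/matrixP=> i j.
by rewrite !mxE; case: eqP => _; rewrite ?mulr0// rmorphM.
Qed.

Lemma rsvdB m n (P : 'M[quat R]_m) (Q : 'M[quat R]_n) d e :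
  rsvd P Q d - rsvd P Q e = rsvd P Q (fun i => d i - e i).
Proof.
rewrite -scaleN1r -(rmorphN1 (@qreal R)) rsvdZ rsvdD.
by apply: rsvd_ext => i _ _; rewrite mulN1r.
Qed.

Lemma rsvd_scalar m (P : 'M[quat R]_m) c : is_unitary P ->
  (qreal c)%:M = rsvd P P (fun=> c).
Proof.
case=> _ PPH; rewrite -[LHS]mulmx1 -PPH mulmxA mul_scalar_mx.
rewrite -{1}[P]mulmx1 qreal_scalemxAr; congr (_ *m _ *m _).
apply/matrixP=> i j; rewrite !mxE -val_eqE.
by case: eqP => _; rewrite ?mulr1 ?mulr0.
Qed.

Lemma rsvdM m n p (P : 'M[quat R]_m) (Q : 'M[quat R]_n) (S : 'M[quat R]_p)
    d e f : is_unitary Q ->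
  (forall i, (i < m)%N -> (i < p)%N ->
     f i = if (i < n)%N then d i * e i else 0) ->
  rsvd P Q d *m rsvd Q S e = rsvd P S f.
Proof.
case=> QHQ _ /rdiagM fE; rewrite /rsvd -fE -!mulmxA; congr (_ *m (_ *m _)).
by rewrite mulmxA QHQ mul1mx.
Qed.

End Diagonal.

(** * The operator norm in diagonal form *)

Section OperatorNorm.
Variable R : realType.
Implicit Types d : nat -> R.

Lemma vnorm_unitary n (P : 'M[quat R]_n) x : is_unitary P ->
  vnorm (P *m x) = vnorm x.
Proof.
by case=> PHP _; rewrite /vnorm adjmxM mulmxA -(mulmxA x^H) PHP mulmx1.
Qed.

Lemma unitary_adj n (P : 'M[quat R]_n) : is_unitary P -> is_unitary P^H.
Proof. by case=> PHP PPH; split; rewrite adjmxK. Qed.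

(** D^H D is a square real diagonal matrix, so y^H (D^H D) y needs only one
    summation even when D is rectangular. *)
Lemma vnorm_rdiag m n d (y : 'cV[quat R]_n) :
  vnorm (rdiag m n d *m y) =
  Num.sqrt (\sum_(j < n) (if (j < m)%N then d j ^+ 2 else 0) *
                         normq2 (y j 0)).
Proof.
rewrite /vnorm adjmxM adj_rdiag mulmxA -(mulmxA y^H).
rewrite (@rdiagM _ _ _ _ _ _ (fun j => if (j < m)%N then d j ^+ 2 else 0)).
  rewrite -mulmxA mxE raddf_sum; congr Num.sqrt; apply: eq_bigr => j _.
  rewrite !mxE (bigD1 j)// big1 => [|k kNj]; last first.
    by rewrite mxE eq_sym val_eqE (negbTE kNj) mul0r.
  by rewrite mxE eqxx -qre_conj_real_mul; congr (qre (_ * _)); exact: addr0.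
by move=> j _ _; rewrite expr2.
Qed.

Lemma vnormE n (y : 'cV[quat R]_n) :
  vnorm y = Num.sqrt (\sum_(j < n) normq2 (y j 0)).
Proof.
rewrite /vnorm mxE raddf_sum; congr Num.sqrt; apply: eq_bigr => j _.
rewrite !mxE -[normq2 _]mul1r -qre_conj_real_mul.
by rewrite (rmorph1 (@qreal R)) mul1r.
Qed.

Lemma vnorm_rsvd_le m n (P : 'M[quat R]_m) (Q : 'M[quat R]_n) d c x :
  is_unitary P -> is_unitary Q -> 0 <= c ->
  (forall i, (i < m)%N -> (i < n)%N -> `|d i| <= c) ->
  vnorm (rsvd P Q d *m x) <= c * vnorm x.
Proof.
move=> uP uQ c0 dc; rewrite /rsvd -!mulmxA vnorm_unitary//.
rewrite -[vnorm x](vnorm_unitary _ (unitary_adj uQ)).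
set y := Q^H *m x; rewrite vnorm_rdiag vnormE.
rewrite -(ger0_norm c0) -sqrtr_sqr -sqrtrM ?sqr_ge0//.
rewrite ler_wsqrtr// mulr_sumr ler_sum// => j _.
rewrite ler_wpM2r ?normq2_ge0//; case: ifP => jm; last exact: sqr_ge0.
by rewrite -real_normK ?num_real// lerXn2r ?nnegrE ?dc.
Qed.

Lemma opnorm_rsvd_le m n (P : 'M[quat R]_m) (Q : 'M[quat R]_n) d c :
  is_unitary P -> is_unitary Q -> 0 <= c ->
  (forall i, (i < m)%N -> (i < n)%N -> `|d i| <= c) ->
  opnorm (rsvd P Q d) <= c.
Proof.
move=> uP uQ c0 dc; have ubc : ubound
    [set vnorm (rsvd P Q d *m x) | x in [set x | vnorm x = 1]] c.
  move=> _ [x /= x1 <-]; rewrite -[c]mulr1 -x1; exact: vnorm_rsvd_le.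
rewrite /opnorm; have [->|/set0P s0] := eqVneq
    [set vnorm (rsvd P Q d *m x) | x in [set x | vnorm x = 1]] set0.
  by rewrite sup0.
exact: ge_sup.
Qed.

(** The unit vector Q e_i is mapped to d_i P e_i. *)
Lemma opnorm_rsvd_ge m n (P : 'M[quat R]_m) (Q : 'M[quat R]_n) d i :
  is_unitary P -> is_unitary Q -> (i < m)%N -> (i < n)%N ->
  `|d i| <= opnorm (rsvd P Q d).
Proof.
move=> uP uQ im lin; apply: ub_le_sup.
  (* any common bound of the |d j| makes the set bounded, e.g. their sum *)
  exists (\sum_(j < n) `|d j|) => _ [x /= x1 <-].
  rewrite -[leRHS]mulr1 -x1; apply: vnorm_rsvd_le => //.
    by rewrite sumr_ge0.
  by move=> j _ jn; rewrite (bigD1 (Ordinal jn))//= lerDl sumr_ge0.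
pose y : 'cV[quat R]_n := delta_mx (Ordinal lin) 0.
have yE j : normq2 (y j 0) = (j == Ordinal lin)%:R.
  by rewrite mxE andbT /normq2; case: eqP => _ /=; rewrite ?expr1n ?expr0n ?addr0.
exists (Q *m y); first rewrite /= vnorm_unitary// vnormE.
  rewrite (bigD1 (Ordinal lin))//= big1 => [|j jNi]; last first.
    by rewrite yE (negbTE jNi).
  by rewrite yE eqxx addr0 sqrtr1.
rewrite /rsvd mulmxA -!(mulmxA P) vnorm_unitary// -(mulmxA _ Q^H) uQ.1 mulmx1.
rewrite vnorm_rdiag (bigD1 (Ordinal lin))//= big1 => [|j jNi]; last first.
  by rewrite yE (negbTE jNi) mulr0.
by rewrite im yE eqxx mulr1 addr0 sqrtr_sqr.
Qed.

Lemma opnorm_rsvd_ge0 m n (P : 'M[quat R]_m) (Q : 'M[quat R]_n) d :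
  0 <= opnorm (rsvd P Q d).
Proof.
rewrite /opnorm; set S := (X in sup X).
have [supS|nsupS] := pselect (has_sup S); last by rewrite sup_out.
have [_ [x x1 _]] := supS.1.
apply: (@le_trans _ _ (vnorm (rsvd P Q d *m x))); first exact: sqrtr_ge0.
by apply: sup_upper_bound => //; exists x.
Qed.

End OperatorNorm.

(** * The scalar iteration *)

Section ScalarIteration.
Variable R : realType.
Implicit Types s x y w q c : R.

Fixpoint scalar_inner s y w l : R * R :=
  if l is l'.+1 then
    let: (y', w') := scalar_inner s y w l' in (w', w' + y' * (1 - s * w'))
  else (y, w).

Definition scalar_step N s x : R :=
  let p := s * x in
  let u := 4^-1 * (x * (13 - p * (15 - p * (7 - p)))) in
  let v := u + x * (1 - s * u) in
  let z := (scalar_inner s u v N).2 in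
  z + x * (1 - s * z).

(** Indexed as usual (2, 1, 3, 4, 7, ...), so that the exponents 3 and 4 of the
    two starting residuals are lucas 2 and lucas 3. *)
Fixpoint lucas n : nat :=
  if n is n'.+1 then
    if n' is n''.+1 then (lucas n' + lucas n'')%N else 1%N
  else 2%N.

Lemma lucasSS n : lucas n.+2 = (lucas n.+1 + lucas n)%N.
Proof. by []. Qed.

Lemma residual_comp s y w :
  1 - s * (w + y * (1 - s * w)) = (1 - s * y) * (1 - s * w).
Proof. ring. Qed.

(** The new residual is the product of the two previous ones, so the exponents
    obey the Lucas recurrence. *)
Lemma residual_inner s y w c l :
  `|1 - s * y| <= c ^+ lucas 2 -> `|1 - s * w| <= c ^+ lucas 3 ->
  `|1 - s * (scalar_inner s y w l).1| <= c ^+ lucas l.+2 /\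
  `|1 - s * (scalar_inner s y w l).2| <= c ^+ lucas l.+3.
Proof.
move=> yc wc; elim: l => [//|l] /=.
case: (scalar_inner s y w l) => y' w' /= [y'c w'c]; split=> //.
by rewrite residual_comp normrM addnC exprD ler_pM.
Qed.

(** The starting residual is (1 - p)^3 (4 - p) / 4 with p = s x, that is
    q^3 (3 + q) / 4; the last factor has modulus at most 1 because |q| <= 1. *)
Lemma residual_step N s x : `|1 - s * x| <= 1 ->
  `|1 - s * scalar_step N s x| <= `|1 - s * x| ^+ (lucas N.+3).+1.
Proof.
set q := 1 - s * x => q1; rewrite /scalar_step.
set u := 4^-1 * _; set v := u + _.
have uq : `|1 - s * u| <= `|q| ^+ lucas 2.
  have -> : 1 - s * u = q ^+ 3 * ((3 + q) / 4) by rewrite /q /u; field.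
  rewrite normrM normrX ler_piMr ?exprn_ge0//.
  by move: q1; rewrite !ler_norml => /andP[? ?]; lra.
have vq : `|1 - s * v| <= `|q| ^+ lucas 3.
  by rewrite residual_comp -/q normrM exprS ler_wpM2l.
rewrite residual_comp -/q normrM exprS ler_wpM2l//.
by case: (residual_inner N uq vq).
Qed.

(** Where the singular value vanishes the iteration starts at 0; it stays at
    0 = 0^-1, so those entries never contribute to the error. *)
Lemma scalar_step_0 N s : scalar_step N s 0 = 0.
Proof.
have inner0 l : scalar_inner s 0 0 l = (0, 0).
  by elim: l => //= l ->; rewrite mul0r addr0.
have step0 z : z = 0 -> z + 0 * (1 - s * z) = 0.
  by move=> ->; rewrite mul0r addr0.
rewrite /scalar_step; set u := 4^-1 * _.
have -> : u = 0 by rewrite /u mul0r mulr0.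
by apply: step0; rewrite mul0r addr0 inner0.
Qed.

Lemma lucas_gt0 n : (0 < lucas n)%N.
Proof. by elim/ltn_ind: n => -[|[|n]]// IH; rewrite lucasSS addn_gt0 IH. Qed.

(** A linear rate is enough for convergence: since the order is at least 2 and
    the residual stays below c, each step gains at least one factor c. *)
Lemma residual_iter N s x c j : `|1 - s * x| <= c -> c <= 1 ->
  `|1 - s * iter j (scalar_step N s) x| <= c ^+ j.+1.
Proof.
move=> xc c1; have c0 : 0 <= c by exact: le_trans xc.
elim: j => [|j IH]; first by rewrite expr1.
have jc : c ^+ j.+1 <= c by rewrite exprS ler_piMr// exprn_ile1.
rewrite iterS (le_trans (residual_step _ _))// ?(le_trans IH)// ?(le_trans jc)//.
rewrite exprS [leRHS]exprS mulrC ler_pM// ?exprn_ge0//.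
rewrite -(prednK (lucas_gt0 N.+3)) exprS (le_trans _ (le_trans IH jc))//.
by rewrite ler_piMr// exprn_ile1// (le_trans IH)// (le_trans jc).
Qed.

End ScalarIteration.

(** * The closed form of the order *)

Section ClosedForm.
Variable R : realType.

Lemma fiboSS N : fibo R N.+2 = fibo R N.+1 + fibo R N.
Proof.
have sq5 : Num.sqrt 5 ^+ 2 = 5 :> R by rewrite sqr_sqrtr.
have goldenE : golden R ^+ 2 = golden R + 1.
  by rewrite /golden expr_div_n sqrrD sq5; field.
have conjE : (1 - golden R) ^+ 2 = (1 - golden R) + 1.
  by rewrite sqrrB goldenE; ring.
have powSS x : x ^+ 2 = x + 1 -> x ^+ N.+2 = x ^+ N.+1 + x ^+ N :> R.
  by move=> xE; rewrite -addn2 exprD xE mulrDr mulr1 -exprSr.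
by rewrite /fibo -mulrDl !powSS//; congr (_ / _); ring.
Qed.

(** Both sides satisfy the Fibonacci recurrence in N; they agree for N = 2
    (11 + 1) and N = 3 (18 + 1). *)
Lemma nu_lucas N : (2 <= N)%N -> nu R N = (lucas N.+3).+1%:R.
Proof.
case: N => [//|[//|k _]]; rewrite /nu subn1 subn2 /= -[RHS]natr1; congr (_ + 1).
have s5 : Num.sqrt 5 != 0 :> R by rewrite sqrtr_eq0 -ltNge.
have f0 : fibo R 0 = 0 by rewrite /fibo subrr mul0r.
have f1 : fibo R 1 = 1 by rewrite /fibo /golden !expr1; field.
(* two consecutive values at a time, as the recurrence has order two *)
suff [] : 11 * fibo R k.+1 + 7 * fibo R k = (lucas k.+4.+1)%:R /\
          11 * fibo R k.+2 + 7 * fibo R k.+1 = (lucas k.+4.+2)%:R by [].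
elim: k => [|k [IH1 IH2]].
  by rewrite fiboSS f0 f1 /=; split; ring.
split=> //; rewrite lucasSS natrD -IH1 -IH2 (fiboSS k.+1) {2}(fiboSS k); ring.
Qed.

End ClosedForm.

(** * QRAPID in the singular bases *)

Section Diagonalization.
Variables (R : realType) (m n : nat).
Variables (U : 'M[quat R]_m) (V : 'M[quat R]_n) (s : nat -> R).
Hypotheses (uU : is_unitary U) (uV : is_unitary V).
Hypothesis s_supp : forall i, (minn m n <= i)%N -> s i = 0.
Implicit Types x y w : nat -> R.

Let A := rsvd U V s.

Let s_m i : (m <= i)%N -> s i = 0.
Proof. by move=> mi; apply: s_supp; rewrite geq_min mi. Qed.

Let s_n i : (n <= i)%N -> s i = 0.
Proof. by move=> ni; apply: s_supp; rewrite geq_min ni orbT. Qed.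

Let mulA x : A *m rsvd V U x = rsvd U U (fun i => s i * x i).
Proof. by apply: rsvdM => // i _ _; case: ltnP => // /s_n ->; rewrite mul0r. Qed.

Let mulX x y : rsvd V U x *m rsvd U U y = rsvd V U (fun i => x i * y i).
Proof. by apply: rsvdM => // i _ ->. Qed.

Let mulP x y : rsvd U U x *m rsvd U U y = rsvd U U (fun i => x i * y i).
Proof. by apply: rsvdM => // i _ ->. Qed.

Let nat_scalar k : (k%:R)%:M = rsvd U U (fun=> k%:R).
Proof. by rewrite -(rmorph_nat (@qreal R)) (rsvd_scalar _ uU). Qed.

(** All corrections in the algorithm, inner and outer, have this form. *)
Let mul_residual y w : rsvd V U w + rsvd V U y *m (1%:M - A *m rsvd V U w) =
  rsvd V U (fun i => w i + y i * (1 - s i * w i)).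
Proof. by rewrite mulA (nat_scalar 1) rsvdB mulX rsvdD. Qed.

Lemma qrapid_inner_rsvd y w l :
  qrapid_inner A (rsvd V U y) (rsvd V U w) l =
  (rsvd V U (fun i => (scalar_inner (s i) (y i) (w i) l).1),
   rsvd V U (fun i => (scalar_inner (s i) (y i) (w i) l).2)).
Proof.
elim: l => [//|l /= ->]; rewrite mul_residual.
by congr pair; apply: rsvd_ext => i _ _; case: scalar_inner.
Qed.

Lemma qrapid_step_rsvd N x : qrapid_step N A (rsvd V U x) =
  rsvd V U (fun i => scalar_step N (s i) (x i)).
Proof.
rewrite /qrapid_step mulA !nat_scalar.
rewrite !(rsvdB, mulP) mulX.
rewrite -(rmorph_nat (@qreal R)) qrealV ?pnatr_eq0// rsvdZ.
by rewrite mul_residual qrapid_inner_rsvd /= mul_residual.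
Qed.

Lemma qrapid_rsvd N alpha j : qrapid N A alpha j =
  rsvd V U (fun i => iter j (scalar_step N (s i)) (alpha * s i)).
Proof.
elim: j => [|j IH]; first by rewrite /qrapid /= adj_rsvd rsvdZ.
by rewrite /qrapid iterS -/(qrapid _ _ _ _) IH qrapid_step_rsvd.
Qed.

Lemma MPinv_rsvd : MPinv A = rsvd V U (fun i => (s i)^-1).
Proof.
apply: MPinv_unique; rewrite /is_MPinv mulA.
have XA : rsvd V U (fun i => (s i)^-1) *m A =
    rsvd V V (fun i => (s i)^-1 * s i).
  by apply: rsvdM => // i _ _; case: ltnP => // /s_m ->; rewrite mulr0.
rewrite XA !adj_rsvd; split=> //.
  apply: rsvdM => // i im _; rewrite im.
  by have [->|s0] := eqVneq (s i) 0; rewrite ?mulr0// mulfV// mul1r.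
rewrite (@rsvdM _ _ _ _ _ _ _ _ _ (fun i => (s i)^-1))// => i im _.
case: ltnP => [_|/s_n ->]; last by rewrite invr0.
by have [->|s0] := eqVneq (s i) 0; rewrite ?invr0 ?mulr0// mulVf// mul1r.
Qed.

Lemma qrapid_error N alpha j : qrapid N A alpha j - MPinv A =
  rsvd V U (fun i =>
    iter j (scalar_step N (s i)) (alpha * s i) - (s i)^-1).
Proof. by rewrite qrapid_rsvd MPinv_rsvd rsvdB. Qed.

End Diagonalization.

(** * Error bounds *)

Section ScalarError.
Variable R : realType.
Implicit Types s x : R.

Lemma scalar_error s x : s != 0 -> `|x - s^-1| = `|s^-1| * `|1 - s * x|.
Proof. by move=> s0; rewrite -normrM distrC mulrBr mulKf// mulr1. Qed.

Lemma scalar_residual s x : s != 0 -> `|1 - s * x| = `|s| * `|x - s^-1|.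
Proof. by move=> s0; rewrite -normrM distrC mulrBr divff. Qed.

Lemma iter_scalar_step_0 N s j : iter j (scalar_step N s) 0 = 0.
Proof. by elim: j => //= j ->; rewrite scalar_step_0. Qed.

(** alpha s^2 lies in (0, 2): the largest singular value s0 is the worst case. *)
Lemma residual_init (alpha s s0 : R) : 0 < s <= s0 -> 0 < alpha < 2 / s0 ^+ 2 ->
  `|1 - s * (alpha * s)| < 1.
Proof.
move=> /andP[s_gt0 ss0] /andP[a0]; have s00 := lt_le_trans s_gt0 ss0.
rewrite ltr_pdivlMr ?exprn_gt0// => a2.
have le2 : alpha * s ^+ 2 <= alpha * s0 ^+ 2.
  by rewrite ler_pM2l// lerXn2r ?nnegrE ?(ltW s_gt0) ?(ltW s00).
have gt0 : 0 < alpha * s ^+ 2 by rewrite mulr_gt0 ?exprn_gt0.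
have -> : s * (alpha * s) = alpha * s ^+ 2 by ring.
by rewrite ltr_norml; apply/andP; split; lra.
Qed.

End ScalarError.

Theorem theorem2 (R : realType) (m n : nat) (A : 'M[quat R]_(m, n))
    (sigma : seq R) (N : nat) (alpha : R)
    (hsigma : nonzero_singular_values A sigma)
    (hr : (0 < size sigma)%N)
    (halpha : 0 < alpha < 2 / sigma`_0 ^+ 2) :
  opnorm (qrapid N A alpha j - MPinv A) @[j --> \oo] --> (0 : R) /\
  forall j : nat,
    let e := opnorm (qrapid N A alpha j - MPinv A) in
    let e' := opnorm (qrapid N A alpha j.+1 - MPinv A) in
    [/\ N = 0%N ->
          e' <= opnorm (MPinv A) * opnorm A ^+ 5 * e ^+ 5,
        N = 1%N \/ N = 2%N ->
          e' <= opnorm (MPinv A) * opnorm A ^+ (4 * (N + 1)) *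
                e ^+ (4 * (N + 1)) &
        (3 <= N)%N ->
          e' <= opnorm (MPinv A) * opnorm A `^ nu R N * e `^ nu R N].
Proof.
have [size_sigma sorted_sigma pos_sigma [U [V [uU uV]]]] := hsigma.
pose s i := sigma`_i; rewrite -/(rdiag m n s) -/(rsvd U V s) => defA.
have s_pos i : (i < size sigma)%N -> 0 < s i.
  by move=> ir; apply: (allP pos_sigma); rewrite mem_nth.
have s_out i : (size sigma <= i)%N -> s i = 0.
  by move=> ?; rewrite /s nth_default.
have s_supp i : (minn m n <= i)%N -> s i = 0.
  by move=> mi; apply: s_out; exact: leq_trans mi.
have s_eq0 i : s i != 0 -> (i < size sigma)%N.
  by move=> si0; rewrite ltnNge; apply: contraNN si0 => /s_out ->.
have s_le i : (i < size sigma)%N -> s i <= s 0%N.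
  have ge_trans : transitive (fun x y : R => y <= x).
    by move=> a b c ab cb; exact: le_trans cb ab.
  move=> ir; exact: (sorted_leq_nth ge_trans (fun x : R => lexx x) 0
    sorted_sigma 0%N i hr ir (leq0n i)).
have init i : (i < size sigma)%N -> `|1 - s i * (alpha * s i)| < 1.
  by move=> ir; apply: (@residual_init _ _ _ (s 0%N)); rewrite ?s_pos ?s_le.
pose rho := \big[Num.max/0]_(i < size sigma) `|1 - s i * (alpha * s i)|.
have rho_ge0 : 0 <= rho by exact: bigmax_ge_id.
have rho_lt1 : rho < 1 by apply: bigmax_lt => // i _; exact: init.
have residual j i : (i < size sigma)%N ->
    `|1 - s i * iter j (scalar_step N (s i)) (alpha * s i)| <= rho ^+ j.+1.
  move=> ir; apply: residual_iter (ltW rho_lt1).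
  exact: (le_bigmax _ (fun i : 'I__ => `|1 - s i * (alpha * s i)|) (Ordinal ir)).
have MPA : MPinv A = rsvd V U (fun i => (s i)^-1) by rewrite defA MPinv_rsvd.
have err j : qrapid N A alpha j - MPinv A = rsvd V U (fun i =>
    iter j (scalar_step N (s i)) (alpha * s i) - (s i)^-1).
  by rewrite defA qrapid_error.
have MP_ge0 : 0 <= opnorm (MPinv A) by rewrite MPA opnorm_rsvd_ge0.
have A_ge0 : 0 <= opnorm A by rewrite defA opnorm_rsvd_ge0.
have e_ge0 j : 0 <= opnorm (qrapid N A alpha j - MPinv A).
  by rewrite err opnorm_rsvd_ge0.
have err0 j i : s i = 0 ->
    iter j (scalar_step N (s i)) (alpha * s i) - (s i)^-1 = 0.
  by move=> ->; rewrite mulr0 iter_scalar_step_0 invr0 subr0.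
have geom j : opnorm (qrapid N A alpha j - MPinv A) <=
    opnorm (MPinv A) * rho ^+ j.+1.
  rewrite err; apply: opnorm_rsvd_le; rewrite ?mulr_ge0 ?exprn_ge0// => i im lin.
  have [/err0 ->|si0] := eqVneq (s i) 0.
    by rewrite normr0 mulr_ge0 ?exprn_ge0.
  rewrite scalar_error// ler_pM// ?residual ?s_eq0//.
  by rewrite MPA (@opnorm_rsvd_ge _ _ _ _ _ (fun i => (s i)^-1)).
have bound_ge0 j K : 0 <= opnorm (MPinv A) *
    (opnorm A * opnorm (qrapid N A alpha j - MPinv A)) ^+ K.
  exact: mulr_ge0 MP_ge0 (exprn_ge0 K (mulr_ge0 A_ge0 (e_ge0 j))).
have order j K : K = (lucas N.+3).+1 ->
    opnorm (qrapid N A alpha j.+1 - MPinv A) <=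
    opnorm (MPinv A) * opnorm A ^+ K *
    opnorm (qrapid N A alpha j - MPinv A) ^+ K.
  move=> KE; rewrite -mulrA -exprMn [X in X <= _](congr1 _ (err j.+1)).
  apply: opnorm_rsvd_le (bound_ge0 _ _) _ => // i im lin.
  have [/err0 ->|si0] := eqVneq (s i) 0; first by rewrite normr0 bound_ge0.
  rewrite scalar_error// ler_pM//.
    by rewrite MPA (@opnorm_rsvd_ge _ _ _ _ _ (fun i => (s i)^-1)).
  rewrite iterS KE; apply: le_trans (residual_step _ _) _.
    by rewrite (le_trans (residual _ _ _)) ?s_eq0// exprn_ile1// ltW.
  have si_A : `|s i| <= opnorm A by rewrite defA (@opnorm_rsvd_ge _ _ _ _ _ s).
  have xi_e : `|iter j (scalar_step N (s i)) (alpha * s i) - (s i)^-1| <=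
      opnorm (qrapid N A alpha j - MPinv A).
    rewrite err; exact: (@opnorm_rsvd_ge _ _ _ _ _ (fun i =>
      iter j (scalar_step N (s i)) (alpha * s i) - (s i)^-1)).
  rewrite scalar_residual// lerXn2r ?nnegrE ?(mulr_ge0 A_ge0 (e_ge0 j))//.
  exact: ler_pM (normr_ge0 _) (normr_ge0 _) si_A xi_e.
split.
  apply: (squeeze_cvgr (f := fun=> 0)
    (h := geometric (opnorm (MPinv A) * rho) rho)).
  - by near=> j; rewrite e_ge0 /= -mulrA -exprS geom.
  - exact: cvg_cst.
  - by apply: cvg_geometric; rewrite ger0_norm.
move=> j e e'; split=> [N0|N12|N3].
- by apply: order; rewrite N0.
- by apply: order; case: N12 => ->.
- rewrite nu_lucas ?(ltnW N3)// (powR_mulrn _ A_ge0) (powR_mulrn _ (e_ge0 j)).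
  exact: order.
Unshelve. all: by end_near.
Qed.
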